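(* Consider the first order forward discretized nonlinear dynamical system with dual linear closure $$\hat{x}^{n+1} = \hat{x}^{n} + \Delta t\,(F(\hat{x}^{n}) + A_{12}\tilde{x}^{n}),\qquad \tilde{x}^{n+1} = \tilde{x}^{n} + \Delta t\,(H(\hat{x}^{n}) + A_{22}\tilde{x}^{n}),\qquad \delta^{n} = A_{12}\tilde{x}^{n}.$$ For $k \in \mathbb{N}^{+}$ define $$\mathcal{O}_{k} = \begin{bmatrix} A_{12} \\ A_{12}A_{22} \\ \vdots \\ A_{12}A_{22}^{k-1}\end{bmatrix} \in \mathbb{R}^{kQ\times (N-Q)}, \qquad r_{\mathcal{O}}(k) = \operatorname{rank}(\mathcal{O}_k).$$ If $\mathcal{O}_{N-Q}$ is of full rank, i.e. $r_{\mathcal{O}}(N-Q) = N-Q$, then there exist $p, n \in \mathbb{N}$ such that, with $\delta \in \mathbb{R}^Q$ and $\hat{x}\in\mathbb{R}^Q$ collected up to step $n$, the vectors $\tilde{x}^{n}, \ldots, \tilde{x}^{n-p}$ can be determined as a linear combination of $H(\hat{x}^{n-1}), \ldots, H(\hat{x}^{n-p}), \delta^{n}, \ldots, \delta^{n-p}$ (for $p = 0$, only $\delta^{n}$ is used). Further, the minimal $p$ with this property is $$p_{*} = \min \Omega_{\mathcal{O}} - 1, \qquad \Omega_{\mathcal{O}} = \{\, l \in \mathbb{N}^{+} : r_{\mathcal{O}}(l) = N-Q \,\}.$$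
   Context: Here $N, Q$ are integers with $1 \le Q < N$, $\Delta t > 0$ is the time step, $\hat{x}^n \in \mathbb{R}^{Q}$ is the resolved state, $\tilde{x}^n \in \mathbb{R}^{N-Q}$ the unresolved state, $F:\mathbb{R}^Q\to\mathbb{R}^Q$ and $H:\mathbb{R}^Q\to\mathbb{R}^{N-Q}$ are functions, $A_{12}\in\mathbb{R}^{Q\times(N-Q)}$, $A_{22}\in\mathbb{R}^{(N-Q)\times(N-Q)}$. The system is the forward Euler discretization of $\frac{d}{dt}\hat{x} = F(\hat{x}) + A_{12}\tilde{x}$, $\frac{d}{dt}\tilde{x} = H(\hat{x}) + A_{22}\tilde{x}$, with closure $\delta = A_{12}\tilde{x}$. ''Can be determined as a linear combination'' is meant with (constant) matrix coefficients: there are real matrices, depending only on $A_{12}, A_{22}, \Delta t, p$, such that the unresolved vectors equal the corresponding matrix combination of the listed vectors for every trajectory segment at times $n-p,\ldots,n$ satisfying the discretized system (with the state $(\hat{x}^{n-p},\tilde{x}^{n-p})$ at the start of the segment arbitrary). *)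

(* Defs.v *)
From HB Require Import structures.
From mathcomp Require Import all_boot all_order all_algebra.
From mathcomp Require Import reals.
Set Implicit Arguments.
Unset Strict Implicit.
Unset Printing Implicit Defensive.
Import Order.TTheory GRing.Theory Num.Theory.
Local Open Scope ring_scope.

(* The resolved state lives in 'cV[R]_q and the unresolved one in 'cV[R]_s
   (q = Q and s = N - Q).  States are column vectors, so matrices act on the
   left by *m. *)

(* \mxcol has \sum_(i < k) q rows, i.e. k * q rows up to a propositional
   equality. *)
Definition obs_mx (R : realType) (q s : nat)
    (A12 : 'M[R]_(q, s)) (A22 : 'M[R]_s) (k : nat) :
    'M[R]_(\sum_(i < k) q, s) :=
  \mxcol_(i < k) (A12 *m A22 ^+ i).

Definition obs_rank (R : realType) (q s : nat)
    (A12 : 'M[R]_(q, s)) (A22 : 'M[R]_s) (k : nat) : nat :=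
  \rank (obs_mx A12 A22 k).

Definition Omega_obs (R : realType) (q s : nat)
    (A12 : 'M[R]_(q, s)) (A22 : 'M[R]_s) (l : nat) : Prop :=
  (0 < l)%N /\ obs_rank A12 A22 l = s.

Definition is_min (P : nat -> Prop) (m : nat) : Prop :=
  P m /\ forall k, P k -> (m <= k)%N.

Definition closure_term (R : realType) (q s : nat) (A12 : 'M[R]_(q, s))
    (xt : nat -> 'cV[R]_s) (m : nat) : 'cV[R]_q :=
  A12 *m xt m.

(* Only the values at times n - p, ..., n matter; the state at time n - p is
   unconstrained.  Meant for p <= n, the subtraction being truncated. *)
Definition euler_segment (R : realType) (q s : nat) (dt : R)
    (F : 'cV[R]_q -> 'cV[R]_q) (H : 'cV[R]_q -> 'cV[R]_s)
    (A12 : 'M[R]_(q, s)) (A22 : 'M[R]_s) (p n : nat)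
    (xh : nat -> 'cV[R]_q) (xt : nat -> 'cV[R]_s) : Prop :=
  forall m, (n - p <= m < n)%N ->
    xh m.+1 = xh m + dt *: (F (xh m) + A12 *m xt m) /\
    xt m.+1 = xt m + dt *: (H (xh m) + A22 *m xt m).

(* B i j and C i j are the matrix coefficients of H (xh^(n-j)) and of
   delta^(n-j) in the expression of xt^(n-i); the first sum is empty when
   p = 0.  Only their values for i, j <= p matter. *)
Definition determined_by (R : realType) (q s : nat) (dt : R)
    (F : 'cV[R]_q -> 'cV[R]_q) (H : 'cV[R]_q -> 'cV[R]_s)
    (A12 : 'M[R]_(q, s)) (A22 : 'M[R]_s) (p n : nat)
    (B : nat -> nat -> 'M[R]_s) (C : nat -> nat -> 'M[R]_(s, q)) : Prop :=
  forall (xh : nat -> 'cV[R]_q) (xt : nat -> 'cV[R]_s),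
    euler_segment dt F H A12 A22 p n xh xt ->
    forall i, (i <= p)%N ->
      xt (n - i)%N =
        \sum_(1 <= j < p.+1) B i j *m H (xh (n - j)%N) +
        \sum_(0 <= j < p.+1) C i j *m closure_term A12 xt (n - j)%N.

(* The coefficients may depend on A12, A22, dt and p only: they are chosen
   before F, H and n. *)
Definition determinable (R : realType) (q s : nat) (dt : R)
    (A12 : 'M[R]_(q, s)) (A22 : 'M[R]_s) (p : nat) : Prop :=
  exists (B : nat -> nat -> 'M[R]_s) (C : nat -> nat -> 'M[R]_(s, q)),
    forall (F : 'cV[R]_q -> 'cV[R]_q) (H : 'cV[R]_q -> 'cV[R]_s) (n : nat),
      (p <= n)%N -> determined_by dt F H A12 A22 p n B C.

(* The same for one given system and some final time n; here the coefficients
   may depend on F, H and n as well, so that non-determinability in this sense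
   is the stronger negative assertion. *)
Definition determinable_for (R : realType) (q s : nat) (dt : R)
    (F : 'cV[R]_q -> 'cV[R]_q) (H : 'cV[R]_q -> 'cV[R]_s)
    (A12 : 'M[R]_(q, s)) (A22 : 'M[R]_s) (p : nat) : Prop :=
  exists n : nat, (p <= n)%N /\
    exists (B : nat -> nat -> 'M[R]_s) (C : nat -> nat -> 'M[R]_(s, q)),
      determined_by dt F H A12 A22 p n B C.

(* Main.v *)
Require Import Defs.
From HB Require Import structures.
From mathcomp Require Import all_boot all_order all_algebra.
From mathcomp Require Import reals.
Set Implicit Arguments.
Unset Strict Implicit.
Unset Printing Implicit Defensive.
Import Order.TTheory GRing.Theory Num.Theory.
Local Open Scope ring_scope.

(** Put M = 1 + dt A22.  Unrolling the recursion for the unresolved state gives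
      xt^(n-i) = M^(p-i) xt^(n-p) + (a fixed matrix combination of the
      H (xh^(n-j)), 1 <= j <= p),
    so, up to the known vectors H (xh^(n-j)), the data delta^(n-p), ..., delta^n
    are the products A12 M^m xt^(n-p) with m <= p.  Everything therefore depends
    on whether the stack of the A12 M^m, m <= p, has trivial kernel.  As dt is
    nonzero, M and A22 are affine functions of each other, so this stack has the
    same kernel as O_(p+1) ([obs_ker_affine]).

    If O_(p+1) has rank s = N - Q, the stack has a left inverse, which recovers
    xt^(n-p) from the data; unrolling then gives the later states
    ([obs_rank_determinable]).

    If the rank is smaller, choose v <> 0 in the kernel and start two
    trajectories at time n - p, with the same resolved state and with unresolved
    states 0 and v.  The difference of the unresolved states propagates as M^m v,
    which A12 kills for all m <= p, so the resolved states, the values of H and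
    the closures coincide on the whole segment, although the states at time
    n - p differ ([determined_obs_rank]).  This works for every F and H, however
    nonlinear, since these only see the common resolved state.

    Hence p is admissible, in the uniform sense or for one given system, exactly
    when p + 1 lies in Omega_O, and the minima correspond. *)

(** * Rank and kernel of the observability matrix *)

Lemma row_full_ker (K : fieldType) (m s : nat) (A : 'M[K]_(m, s)) :
  row_full A <-> (forall v : 'cV[K]_s, A *m v = 0 -> v = 0).
Proof.
split=> [/row_fullP[L LA] v Av0|kerA].
  by rewrite -[v]mul1mx -LA -mulmxA Av0 mulmx0.
rewrite -cokermx_eq0; apply/eqP/matrixP=> i j.
have /kerA/matrixP/(_ i 0) : A *m col j (cokermx A) = 0.
  by rewrite colE mulmxA mulmx_coker mul0mx.
by rewrite !mxE.
Qed.

Section Observability.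

Variables (R : realType) (q s : nat).
Implicit Types (C : 'M[R]_(q, s)) (A : 'M[R]_s) (v : 'cV[R]_s).

Definition obs_ker C A (k : nat) v : Prop :=
  forall m, (m < k)%N -> C *m A ^+ m *m v = 0.

Lemma obs_mx_ker C A k v : obs_mx C A k *m v = 0 <-> obs_ker C A k v.
Proof.
rewrite -mxcolP; split=> [E m ltmk|E i].
  by have := E (Ordinal ltmk); rewrite -submxcol_mul mxcolK submxcol0.
by rewrite -submxcol_mul mxcolK submxcol0 E.
Qed.

Lemma obs_rank_ker C A k :
  obs_rank C A k = s <-> (forall v, obs_ker C A k v -> v = 0).
Proof.
have -> : obs_rank C A k = s <-> row_full (obs_mx C A k).
  by split=> [/eqP|/eqP].
rewrite row_full_ker.
by split=> kerO v /obs_mx_ker/kerO.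
Qed.

Lemma obs_rank_left_inverse C A k : obs_rank C A k = s ->
  exists L : nat -> 'M[R]_(s, q), \sum_(0 <= m < k) L m *m (C *m A ^+ m) = 1%:M.
Proof.
move=> /eqP/row_fullP[L LO].
exists (fun m => if insub m is Some i then submxrow L i else 0).
rewrite big_mkord -LO -[in RHS](submxrowK L) mul_mxrow_mxcol.
by apply: eq_bigr => i _; rewrite valK.
Qed.

(** The kernel depends only on the span of 1, A, ..., A^(k-1), and the powers of
    a%:M + b *: A below k lie in that span.  In the induction, applying
    a%:M + b *: A once costs one level of the kernel. *)
Lemma obs_ker_affine C A (a b : R) k v :
  obs_ker C A k v -> obs_ker C (a%:M + b *: A) k v.
Proof.
move=> kerv m; elim: m => [|m IHm] in k v kerv *.
  by move=> ltk; have := kerv 0%N ltk; rewrite !expr0.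
case: k kerv => // k kerv; rewrite ltnS => ltmk.
rewrite exprSr -[_ ^+ m * _]/(_ ^+ m *m _) mulmxA -mulmxA.
apply: (IHm k) => // i ltik.
rewrite mulmxDl mul_scalar_mx mulmxDr -scalemxAr -scalemxAl -scalemxAr mulmxA.
rewrite -(mulmxA C _ A) -[A ^+ i *m A]exprSr !kerv ?scaler0 ?addr0 //.
exact: ltnW.
Qed.

Definition euler_mx (dt : R) A : 'M[R]_s := 1%:M + dt *: A.

Lemma obs_ker_euler (dt : R) C A k v : dt != 0 ->
  obs_ker C (euler_mx dt A) k v <-> obs_ker C A k v.
Proof.
move=> dt0; split; last exact: obs_ker_affine.
have {2}-> : A = (- dt^-1)%:M + dt^-1 *: euler_mx dt A.
  by rewrite scalerDr scalerA mulVf // scale1r scalemx1 raddfN addKr.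
exact: obs_ker_affine.
Qed.

Lemma obs_rank_euler (dt : R) C A k : dt != 0 ->
  obs_rank C A k = s -> obs_rank C (euler_mx dt A) k = s.
Proof.
move=> dt0 /obs_rank_ker kerA; apply/obs_rank_ker => v.
by rewrite obs_ker_euler //; apply: kerA.
Qed.

End Observability.

(** * Full rank makes the unresolved states computable *)

Section EulerSegments.

Variables (R : realType) (q s : nat) (dt : R).
Variables (A12 : 'M[R]_(q, s)) (A22 : 'M[R]_s).
Local Notation M := (euler_mx dt A22).

(** The matrix with which H (xh^(n-j)) contributes to xt^(n-i): it enters at time
    n - j + 1 and is then propagated j - i - 1 times. *)
Definition source_mx (i j : nat) : 'M[R]_s :=
  if (i < j)%N then dt *: M ^+ (j - i.+1) else 0.

Lemma source_mx_step i j :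
  source_mx i j = M *m source_mx i.+1 j + (j == i.+1)%:R *: dt%:M.
Proof.
rewrite /source_mx; case: (ltngtP j i.+1) => [_|ltij|->].
- by rewrite scale0r mulmx0 addr0.
- by rewrite scale0r addr0 -scalemxAr -[M *m _]exprS subnSK.
- by rewrite subnn scale1r mulmx0 add0r scalemx1.
Qed.

Lemma euler_segment_unroll F H p n xh xt i : (p <= n)%N ->
  euler_segment dt F H A12 A22 p n xh xt -> (i <= p)%N ->
  xt (n - i)%N = M ^+ (p - i) *m xt (n - p)%N +
    \sum_(1 <= j < p.+1) source_mx i j *m H (xh (n - j)%N).
Proof.
move=> lepn seg leip.
(* Induction forward in time, on d = p - i: the start i = p of the segment is
   the base case. *)
have [d def_d] : exists d, (p - i)%N = d by exists (p - i)%N.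
elim: d => [|d IHd] in i leip def_d *.
  have -> : i = p by apply/eqP; rewrite eqn_leq leip -subn_eq0 def_d.
  rewrite subnn mul1mx big_nat big1 ?addr0 // => j /andP[_ lejp].
  by rewrite /source_mx ltnNge -ltnS lejp mul0mx.
have ltip : (i < p)%N by rewrite -subn_gt0 def_d.
have ltin : (i < n)%N := leq_trans ltip lepn.
have [|_] := seg (n - i.+1)%N.
  by rewrite leq_sub2l // ltn_subrL (leq_trans _ ltin).
rewrite subnSK // => ->.
rewrite scalerDr addrCA addrC scalemxAl -[X in X + dt *: A22 *m _]mul1mx -mulmxDl.
rewrite -/(euler_mx dt A22) IHd //; last by rewrite subnS def_d.
rewrite mulmxDr mulmxA -[M *m _ ^+ _]exprS subnSK // -addrA; congr (_ + _).
under [RHS]eq_bigr do rewrite source_mx_step mulmxDl.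
rewrite big_split mulmx_sumr /=; congr (_ + _).
  by apply: eq_bigr => j _; rewrite mulmxA.
(* Only H (xh^(n-i-1)) enters in the step from n - i - 1 to n - i. *)
rewrite (bigD1_seq i.+1) ?mem_index_iota ?iota_uniq //= eqxx scale1r.
rewrite mul_scalar_mx big1 ?addr0 // => j /negPf->.
by rewrite scale0r mul0mx.
Qed.

(** Full rank provides matrices L m with sum_m L m A12 M^m = 1.  Reading off
    A12 M^m xt^(n-p) from delta^(n-p+m) with the unrolled recursion then
    expresses xt^(n-p) in the data, and unrolling once more gives xt^(n-i). *)
Lemma obs_rank_determinable p : dt != 0 ->
  obs_rank A12 A22 p.+1 = s -> determinable dt A12 A22 p.
Proof.
move=> dt0 /(obs_rank_euler dt0)/obs_rank_left_inverse[L LK].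
exists (fun i j => source_mx i j - M ^+ (p - i) *m
          \sum_(0 <= r < p.+1) L (p - r)%N *m (A12 *m source_mx r j)).
exists (fun i j => M ^+ (p - i) *m L (p - j)%N).
move=> F H n lepn xh xt seg i leip.
pose S r := \sum_(1 <= j < p.+1) source_mx r j *m H (xh (n - j)%N).
have start : xt (n - p)%N = \sum_(0 <= r < p.+1)
    L (p - r)%N *m (closure_term A12 xt (n - r)%N - A12 *m S r).
  rewrite -[LHS]mul1mx -LK mulmx_suml big_nat_rev /=.
  rewrite big_nat [RHS]big_nat; apply: eq_bigr => r /andP[_ lerp].
  rewrite add0n subSS /closure_term (euler_segment_unroll lepn seg lerp) -/(S r).
  by rewrite mulmxDr addrK !mulmxA.
rewrite (euler_segment_unroll lepn seg leip) -/(S i) {1}start.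
under eq_bigr do rewrite mulmxBr.
rewrite sumrB mulmxBr -addrA addrC [- _ + _]addrC; congr (_ + _).
  under [RHS]eq_bigr do rewrite mulmxBl.
  rewrite sumrB; congr (_ - _).
  under [RHS]eq_bigr do rewrite -mulmxA mulmx_suml.
  rewrite -mulmx_sumr exchange_big /=; congr (_ *m _).
  apply: eq_bigr => r _; rewrite !mulmx_sumr.
  by apply: eq_bigr => j _; rewrite !mulmxA.
by rewrite mulmx_sumr; apply: eq_bigr => r _; rewrite mulmxA.
Qed.

(** * Rank deficiency produces indistinguishable trajectories *)

Section Trajectory.

Variables (F : 'cV[R]_q -> 'cV[R]_q) (H : 'cV[R]_q -> 'cV[R]_s).

Definition euler_step (z : 'cV[R]_q * 'cV[R]_s) : 'cV[R]_q * 'cV[R]_s :=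
  (z.1 + dt *: (F z.1 + A12 *m z.2), z.2 + dt *: (H z.1 + A22 *m z.2)).

Definition euler_flow (v : 'cV[R]_s) (m : nat) := iter m euler_step (0, v).

(** The flow starts at time n - p; earlier times give the junk value of the
    truncated subtraction, which the segment does not see. *)
Lemma euler_flow_segment p n v :
  euler_segment dt F H A12 A22 p n
    (fun m => (euler_flow v (m - (n - p))).1)
    (fun m => (euler_flow v (m - (n - p))).2).
Proof. by move=> m /andP[lem _]; rewrite /euler_flow subSn. Qed.

(** Once the resolved states agree, the unknown F and H cancel in the difference
    of the two trajectories, which is therefore governed by the linear part. *)
Lemma euler_flow_shift p v : obs_ker A12 M p.+1 v ->
  forall m, (m <= p)%N ->
    euler_flow v m = ((euler_flow 0 m).1, (euler_flow 0 m).2 + M ^+ m *m v).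
Proof.
move=> kerv; elim=> [|m IHm] ltmp; first by rewrite /= mul1mx add0r.
rewrite [LHS]/= -/(euler_flow v m) IHm ?(ltnW ltmp) // /euler_step /=.
rewrite -/(euler_flow 0 m) !mulmxDr [A12 *m (_ *m v)]mulmxA kerv ?addr0; last first.
  exact: leqW.
congr pair; rewrite exprS -[M * _]/(M *m _) -mulmxA {2}/euler_mx mulmxDl mul1mx.
by rewrite -scalemxAl !scalerDr (addrA (dt *: H _)) addrACA.
Qed.

(** Given v in the kernel, the trajectories started at 0 and at v at time n - p
    have the same data, so any formula in the data, whatever its coefficients,
    gives them the same state at that time, that is v = 0. *)
Lemma determined_obs_rank p n B C : dt != 0 -> (p <= n)%N ->
  determined_by dt F H A12 A22 p n B C -> obs_rank A12 A22 p.+1 = s.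
Proof.
move=> dt0 lepn det; apply/obs_rank_ker => v /(obs_ker_euler _ _ _ _ dt0) kerv.
have := det _ _ (euler_flow_segment v) p (leqnn p).
have := det _ _ (euler_flow_segment 0) p (leqnn p).
have le_p j : (n - j - (n - p) <= p)%N.
  by rewrite -[leqRHS](subKn lepn) leq_sub2r ?leq_subr.
rewrite /= subnn /= => E0 ->; rewrite [RHS]E0.
congr (_ + _); apply: eq_bigr => j _.
  by rewrite (euler_flow_shift kerv).
rewrite /closure_term (euler_flow_shift kerv) //.
by rewrite mulmxDr mulmxA kerv ?addr0 // ltnS.
Qed.

End Trajectory.

End EulerSegments.

(** * The minimal number of steps *)

Lemma is_min_ext (P P' : nat -> Prop) m :
  (forall k, P k <-> P' k) -> is_min P m -> is_min P' m.
Proof.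
by move=> PP' [Pm minm]; split=> [|k /PP'/minm //]; apply/PP'.
Qed.

Lemma is_min_exists (P : pred nat) : (exists k, P k) -> exists m, is_min P m.
Proof. by move=> exP; case: (ex_minnP exP) => m Pm minm; exists m. Qed.

Theorem theorem5p2 (R : realType) (N Q : nat) (hQ : (1 <= Q)%N) (hN : (Q < N)%N)
    (dt : R) (hdt : 0 < dt)
    (A12 : 'M[R]_(Q, N - Q)) (A22 : 'M[R]_(N - Q))
    (hfull : obs_rank A12 A22 (N - Q) = (N - Q)%N) :
  (exists p n : nat, (p <= n)%N /\
     exists (B : nat -> nat -> 'M[R]_(N - Q))
            (C : nat -> nat -> 'M[R]_(N - Q, Q)),
       forall (F : 'cV[R]_Q -> 'cV[R]_Q) (H : 'cV[R]_Q -> 'cV[R]_(N - Q)),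
         determined_by dt F H A12 A22 p n B C) /\
  (exists l : nat,
     [/\ is_min (Omega_obs A12 A22) l,
         is_min (determinable dt A12 A22) (l - 1)
       & forall (F : 'cV[R]_Q -> 'cV[R]_Q) (H : 'cV[R]_Q -> 'cV[R]_(N - Q)),
           is_min (determinable_for dt F H A12 A22) (l - 1)]).
Proof.
have dt0 : dt != 0 by rewrite gt_eqF.
have [l minl] : exists l, is_min (Omega_obs A12 A22) l.
  pose P l := (0 < l)%N && (obs_rank A12 A22 l == N - Q)%N.
  have [|m minP] := @is_min_exists P.
    by exists (N - Q)%N; rewrite /P subn_gt0 hN hfull eqxx.
  exists m; apply: is_min_ext minP => k.
  by split=> [/andP[k0 /eqP]|[k0 rk]]; rewrite /P ?k0 ?rk ?eqxx.
have [[l0 rkl] lel] := minl.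
have det_l : determinable dt A12 A22 (l - 1).
  by apply: obs_rank_determinable; rewrite // subn1 prednK.
have [B [C detBC]] := det_l.
have determinable_ge F H p : determinable_for dt F H A12 A22 p -> (l - 1 <= p)%N.
  case=> n [lepn [B' [C' /(determined_obs_rank dt0 lepn) rkp]]].
  by rewrite leq_subLR add1n; apply: lel.
split.
  exists (l - 1)%N, (l - 1)%N; split=> //; exists B, C => F H.
  exact: detBC.
exists l; split=> //.
  (* The uniform coefficients are tested on a single system. *)
  split=> // p [B' [C' det]].
  apply: (determinable_ge (fun=> 0) (fun=> 0)); exists p; split=> //.
  by exists B', C'; apply: det.
(* For one given system the segment may be placed at the times 0, ..., p. *)
move=> F H; split; last exact: determinable_ge.
by exists (l - 1)%N; split=> //; exists B, C; apply: detBC.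
Qed.
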